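(* Let $X$ be a Banach space and let $U:T\to\mathcal{B}(X)$ be an evolution operator. Then $U$ is weakly exponentially unstable if and only if there are constants $p,M,K\geq 1$ and $\omega>0$ such that for each $x_0\in X$ there is $t_0\geq 0$ for which both of the following hold: (i) $\|U(s,t_0)x_0\|\leq M e^{\omega(t-s)}\|U(t,t_0)x_0\|$ for all $t\geq s\geq t_0$; (ii) $\sum_{n=0}^{[t-t_0]}\|U(t-n,t_0)x_0\|^{p}\leq K\|U(t,t_0)x_0\|^{p}$ for all $t\geq t_0$.
   Context: $X$ is a Banach space, $\mathcal{B}(X)$ is the Banach algebra of all bounded linear operators on $X$, $\mathbb{R}_+=[0,\infty)$, and $T=\{(t,s)\in\mathbb{R}_+^2 : t\geq s\}$. For a real number $r\ge 0$, $[r]$ denotes its integer part (the largest integer not exceeding $r$). A map $U:T\to\mathcal{B}(X)$ is an evolution operator if: $U(t,t)=I$ (the identity on $X$) for every $t\geq 0$; $U(t,s)U(s,t_0)=U(t,t_0)$ for all $(t,s),(s,t_0)\in T$; and for each $x\in X$ the function $T\ni(t,s)\mapsto U(t,s)x\in X$ is continuous. An evolution operator $U$ is weakly exponentially unstable if there are constants $N\geq 1$ and $\nu>0$ such that for each $x_0\in X$ there is $t_0=t_0(x_0)\geq 0$ with $N\|U(t,t_0)x_0\|\geq e^{\nu(t-s)}\|U(s,t_0)x_0\|$ for all $t\geq s\geq t_0$. *)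

(* Defs.v *)
From HB Require Import structures.
From mathcomp Require Import all_boot all_order all_algebra.
From mathcomp Require Import all_classical all_reals all_analysis.

Set Implicit Arguments.
Unset Strict Implicit.
Unset Printing Implicit Defensive.

Import Order.TTheory GRing.Theory Num.Theory.
Import numFieldNormedType.Exports.

Local Open Scope classical_set_scope.
Local Open Scope ring_scope.

Definition bounded_operator (R : realType) (X : normedModType R)
    (A : {linear X -> X}) : Prop :=
  exists C : R, forall x : X, `|A x| <= C * `|x|.

Definition time_pairs (R : realType) : set (R * R) :=
  [set ts | 0 <= ts.2 <= ts.1].

(* An evolution operator on a Banach space is a map on time_pairs only: U is
   total here, and its values outside time_pairs are unconstrained. *)
Definition evolution_operator (R : realType) (X : completeNormedModType R)
    (U : R -> R -> {linear X -> X}) : Prop :=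
  [/\ forall t s : R, 0 <= s <= t -> bounded_operator (U t s),
      forall (t : R) (x : X), 0 <= t -> U t t x = x,
      forall (t s t0 : R) (x : X), 0 <= t0 -> t0 <= s -> s <= t ->
        U t s (U s t0 x) = U t t0 x &
      forall x : X, {within @time_pairs R,
        continuous (fun ts : R * R => U ts.1 ts.2 x)}].

Definition weakly_exponentially_unstable (R : realType)
    (X : completeNormedModType R) (U : R -> R -> {linear X -> X}) : Prop :=
  exists N nu : R, [/\ 1 <= N, 0 < nu &
    forall x0 : X, exists2 t0 : R, 0 <= t0 &
      forall t s : R, t0 <= s -> s <= t ->
        expR (nu * (t - s)) * `|U s t0 x0| <= N * `|U t t0 x0|].

(* Main.v *)
Require Import Defs.
From HB Require Import structures.
From mathcomp Require Import all_boot all_order all_algebra.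
From mathcomp Require Import all_classical all_reals all_analysis.
From mathcomp Require Import ring lra.

Import Order.TTheory GRing.Theory Num.Theory.
Import numFieldNormedType.Exports.

(** Everything takes place on a single orbit: with [x0] and [t0] fixed, both
conditions only speak of the nonnegative function [f t = `|U t t0 x0|] for
[t0 <= t], so the theorem is a statement about scalar functions in which the
constants obtained do not depend on [f] or [t0].

If [f] grows exponentially, with constants [N] and [nu], then the samples
[f (t - n)] decay geometrically in [n] with ratio [expR (- nu)] relative to
[f t]; summing the geometric series gives (ii) with [p = 1]
([backward_sum_le_of_growth]), and (i) is weaker than growth.

Conversely let [g = f ^ p] and let [S t] be the sum of [g] over [t], [t - 1],
[t - 2], and so on as long as the times are at least [t0].  As [S (t + 1) = g (t + 1) + S t] while (ii)
says that [g (t + 1)] is at least the fraction [1 / K] of [S (t + 1)], hence of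
[S t], every unit of time multiplies [S] by at least [1 + 1 / K].  Since [S] and
[g] are comparable by (ii), [g] grows geometrically along [s + n]
([geometric_growth_of_backward_sum]).  Taking [p]-th roots gives exponential
growth of [f] at integer time steps ([integer_step_growth_of_backward_sum]), and
(i) bounds the loss over the remaining fraction of a unit ([exp_growth_of_integer_steps]). *)

Local Open Scope classical_set_scope.
Local Open Scope ring_scope.

Section ScalarGrowth.
Context {R : realType}.
Implicit Types (f g : R -> R) (s t K M N nu omega p q : R).

Definition backward_sum g t0 t : R :=
  \sum_(0 <= n < (Num.truncn (t - t0)).+1) g (t - n%:R).

Lemma backward_sumS g t0 t : t0 <= t ->
  backward_sum g t0 (t + 1) = g (t + 1) + backward_sum g t0 t.
Proof.
move=> t0t; rewrite /backward_sum.
have -> : Num.truncn (t + 1 - t0) = (Num.truncn (t - t0)).+1.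
  have gap0 : 0 <= t - t0 by rewrite subr_ge0.
  apply: truncn_def; have /andP[lb ub] := truncn_itv gap0.
  by move: ub; rewrite -!natr1; lra.
rewrite big_nat_recl// subr0; congr (_ + _).
by apply: eq_bigr => n _; rewrite -natr1; congr g; ring.
Qed.

Lemma le_backward_sum g t0 t : (forall u, 0 <= g u) -> g t <= backward_sum g t0 t.
Proof.
move=> g0; rewrite /backward_sum big_nat_recl// subr0 lerDl.
exact: sumr_ge0.
Qed.

(** The recursion [S (t + 1) = g (t + 1) + S t] turns domination of the sum by
its last term into growth of the sum by the factor [1 + K^-1]. *)
Lemma geometric_growth_of_backward_sum g t0 K s n :
    (forall u, 0 <= g u) -> 0 < K ->
    (forall t, t0 <= t -> backward_sum g t0 t <= K * g t) ->
    t0 <= s ->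
  (1 + K^-1) ^+ n * g s <= K * g (s + n%:R).
Proof.
move=> g0 K0 gK t0s.
have t0sn m : t0 <= s + m%:R by rewrite (le_trans t0s)// lerDl.
apply: le_trans (gK _ (t0sn n)).
elim: n => [|n IH]; first by rewrite expr0 mul1r addr0; exact: le_backward_sum.
have /(le_trans _) -> // : (1 + K^-1) * backward_sum g t0 (s + n%:R)
    <= backward_sum g t0 (s + n.+1%:R); last first.
  by rewrite exprS -mulrA ler_wpM2l// addr_ge0// invr_ge0 ltW.
have := gK _ (t0sn n.+1).
rewrite -natr1 addrA backward_sumS// => gS.
rewrite mulrDl mul1r [leRHS]addrC lerD2l mulrC ler_pdivrMr// mulrC.
by apply: le_trans gS; rewrite lerDr.
Qed.

(** A time gap is an integer number of steps followed by less than one unit of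
time; the loss on the latter is at most [M * expR omega], and the factor
[expR nu] accounts for the rounding in the exponent. *)
Lemma exp_growth_of_integer_steps f t0 K M omega nu :
    (forall u, 0 <= f u) -> 0 <= K -> 0 <= M -> 0 <= omega -> 0 <= nu ->
    (forall t s, t0 <= s -> s <= t -> f s <= M * expR (omega * (t - s)) * f t) ->
    (forall s n, t0 <= s -> expR (nu * n%:R) * f s <= K * f (s + n%:R)) ->
  forall t s, t0 <= s -> s <= t ->
  expR (nu * (t - s)) * f s <= K * M * expR (omega + nu) * f t.
Proof.
move=> f0 K0 M0 w0 nu0 fM fK t s t0s st.
have gap0 : 0 <= t - s by rewrite subr_ge0.
have /andP[] := truncn_itv gap0; set n := Num.truncn _.
rewrite -natr1 => nts tsn.
have step : f (s + n%:R) <= M * expR omega * f t.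
  apply: le_trans (fM t _ _ _) _; [by rewrite (le_trans t0s)// lerDl|by lra|].
  rewrite ler_wpM2r// ler_wpM2l// ler_expR ler_piMr//; lra.
have -> : K * M * expR (omega + nu) * f t = expR nu * (K * (M * expR omega * f t)).
  by rewrite expRD; ring.
apply: (@le_trans _ _ (expR nu * (expR (nu * n%:R) * f s))).
  rewrite mulrA -expRD ler_wpM2r// ler_expR.
  have -> : nu + nu * n%:R = nu * (1 + n%:R) by ring.
  by rewrite ler_wpM2l//; lra.
rewrite ler_wpM2l ?expR_ge0//; apply: le_trans (fK _ _ t0s) _.
exact: ler_wpM2l.
Qed.

(** With [nu = ln (1 + K^-1) / p], the ratio [1 + K^-1] for [f ^ p] is the ratio
[expR nu] for [f]; the root of [K] is bounded by [K] itself as [1 <= K]. *)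
Lemma integer_step_growth_of_backward_sum f t0 K p s n :
    (forall u, 0 <= f u) -> 1 <= K -> 1 <= p ->
    (forall t, t0 <= t ->
       backward_sum (fun u => f u `^ p) t0 t <= K * f t `^ p) ->
    t0 <= s ->
  expR (ln (1 + K^-1) / p * n%:R) * f s <= K * f (s + n%:R).
Proof.
move=> f0 K1 p1 fK t0s.
have K0 : 0 < K by lra.
have p0 : 0 < p by lra.
have q0 : 0 < 1 + K^-1 by rewrite addr_gt0// invr_gt0.
have root x y : 0 <= x -> 0 <= y -> x `^ p <= y `^ p -> x <= y.
  move=> x0 y0; apply: contraTT; rewrite -!ltNge.
  by apply: gt0_ltr_powR; rewrite ?nnegrE.
apply: root; rewrite ?mulr_ge0 ?expR_ge0 ?(ltW K0)//.
apply: le_trans (le1r_powRZ K1 (f0 _) p1).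
rewrite powRM ?expR_ge0// -expRM mulrAC divfK ?gt_eqF//.
rewrite expRM_natr lnK ?posrE//.
apply: (@geometric_growth_of_backward_sum (fun u => f u `^ p) t0) => // u.
exact: powR_ge0.
Qed.

Lemma geometric_sum_le q m : 0 <= q -> q < 1 ->
  \sum_(0 <= n < m) q ^+ n <= (1 - q)^-1.
Proof.
move=> q0 q1; rewrite -[leRHS]mul1r ler_pdivlMr ?subr_gt0// mulrC big_mkord.
by rewrite -opprB mulNr -subrX1 opprB gerBl exprn_ge0.
Qed.

(** Growth gives [f (t - n) <= N * expR (- nu) ^+ n * f t], so the sum is at most
a geometric series. *)
Lemma backward_sum_le_of_growth f t0 N nu t :
    (forall u, 0 <= f u) -> 0 <= N -> 0 < nu ->
    (forall t s, t0 <= s -> s <= t -> expR (nu * (t - s)) * f s <= N * f t) ->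
    t0 <= t ->
  backward_sum f t0 t <= N / (1 - expR (- nu)) * f t.
Proof.
move=> f0 N0 nu0 fN t0t.
have q1 : expR (- nu) < 1 by rewrite expR_lt1 oppr_lt0.
apply: (@le_trans _ _
  (\sum_(0 <= n < (Num.truncn (t - t0)).+1) expR (- nu) ^+ n * (N * f t))).
  rewrite /backward_sum !big_nat; apply: ler_sum => n /=.
  rewrite ltnS => nt.
  have {}nt : n%:R <= t - t0.
    have gap0 : 0 <= t - t0 by rewrite subr_ge0.
    have /andP[lb _] := truncn_itv gap0.
    by apply: le_trans lb; rewrite ler_nat.
  have := fN t (t - n%:R); rewrite subKr lerBrDr -lerBrDl => /(_ nt).
  rewrite gerBl ler0n => /(_ isT) le_n.
  rewrite -expRM_natr mulNr expRN mulrC ler_pdivlMr ?expR_gt0//.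
  by rewrite mulrC.
rewrite -mulr_suml mulrAC [N * _ / _]mulrC.
by rewrite ler_wpM2r ?mulr_ge0// geometric_sum_le// expR_ge0.
Qed.

End ScalarGrowth.

Theorem corollary15 (R : realType) (X : completeNormedModType R)
    (U : R -> R -> {linear X -> X}) (hU : evolution_operator U) :
  weakly_exponentially_unstable U <->
  exists p M K omega : R, [/\ 1 <= p, 1 <= M, 1 <= K, 0 < omega &
    forall x0 : X, exists2 t0 : R, 0 <= t0 &
      (forall t s : R, t0 <= s -> s <= t ->
         `|U s t0 x0| <= M * expR (omega * (t - s)) * `|U t t0 x0|) /\
      (forall t : R, t0 <= t ->
         \sum_(0 <= n < (Num.truncn (t - t0)).+1)
             `|U (t - n%:R) t0 x0| `^ p
           <= K * `|U t t0 x0| `^ p)].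
Proof.
split.
  move=> [N [nu [N1 nu0 growth]]].
  have N0 : 0 <= N by lra.
  have q1 : expR (- nu) < 1 by rewrite expR_lt1 oppr_lt0.
  have q0 : 0 < expR (- nu) := expR_gt0 _.
  exists 1, N, (N / (1 - expR (- nu))), nu; split => //.
    by rewrite ler_pdivlMr ?subr_gt0// mul1r; lra.
  move=> x0; have [t0 t00 f_growth] := growth x0.
  exists t0 => //; split=> [t s t0s st|t t0t].
    have := f_growth t s t0s st; rewrite mulrAC; set e := expR _ => ef.
    have e1 : 1 <= e by rewrite -expR0 ler_expR mulr_ge0 ?(ltW nu0)// subr_ge0.
    have fsN : `|U s t0 x0| <= N * `|U t t0 x0|.
      by apply: le_trans ef; rewrite ler_peMl.
    by apply: (le_trans fsN); rewrite ler_peMr// mulr_ge0.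
  rewrite powRr1//; under eq_bigr do rewrite powRr1//.
  exact: (@backward_sum_le_of_growth _ (fun u => `|U u t0 x0|)).
move=> [p [M [K [omega [p1 M1 K1 w0 bounds]]]]].
have K0 : 0 < K by lra.
pose nu := ln (1 + K^-1) / p.
have nu0 : 0 < nu.
  by rewrite divr_gt0 ?ln_gt0 ?ltrDl ?invr_gt0//; lra.
exists (K * M * expR (omega + nu)), nu; split => //.
  rewrite -!mulrA !mulr_ege1// -expR0 ler_expR; lra.
move=> x0; have [t0 t00 [decay sums]] := bounds x0.
exists t0 => //.
apply: (@exp_growth_of_integer_steps _ (fun u => `|U u t0 x0|)) => //; try lra.
move=> s n; exact: (@integer_step_growth_of_backward_sum _
  (fun u => `|U u t0 x0|)).
Qed.
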